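(* In the group $(\mathbb{Z},+)$, the saturated subsets are: the set $\{x \mid x=2l+1,\ l\in\mathbb{Z}\}$ of all odd integers; the sets $\{a,a+x,a+2x\}$ with $a$ even and $x$ odd; and the sets $\{a,a+4x\}$ with $a$ even and $x\neq 0$.
   Context: For a set $S$ with a binary operation, a subset $U\subseteq S$ is avoidable if there is a partition $\{A,B\}$ of $S$ such that no element of $U$ is the product (here: sum) of two distinct elements of $A$ or of two distinct elements of $B$. A subset is saturated if it is maximal with respect to inclusion among the avoidable subsets of $S$. *)

(* Defs.v *)
From mathcomp Require Import all_boot all_order all_algebra.
From mathcomp Require Import classical_sets.

Set Implicit Arguments.
Unset Strict Implicit.
Unset Printing Implicit Defensive.

Local Open Scope classical_set_scope.

(* Both blocks are nonempty, as in [classical_sets.partition]. *)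
Definition partition2 (S : Type) (A B : set S) : Prop :=
  [/\ A !=set0, B !=set0, A `&` B = set0 & A `|` B = setT].

Definition distinct_product_free (S : Type) (op : S -> S -> S) (U A : set S)
    : Prop :=
  forall x y, A x -> A y -> x <> y -> ~ U (op x y).

Definition avoidable (S : Type) (op : S -> S -> S) (U : set S) : Prop :=
  exists A B : set S, [/\ partition2 A B,
    distinct_product_free op U A & distinct_product_free op U B].

Definition saturated (S : Type) (op : S -> S -> S) (U : set S) : Prop :=
  avoidable op U /\ forall V : set S, avoidable op V -> U `<=` V -> V = U.

(* Main.v *)
Require Import Defs.
From mathcomp Require Import all_boot all_order all_algebra.
From mathcomp Require Import classical_sets.
From mathcomp Require Import boolp zify ring.

(* [U] is avoidable iff the graph on the integers joining distinct [x], [y]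
   with [x + y] in [U] is bipartite.  Three distinct elements of [U] with even
   sum yield a triangle, so an avoidable set with an even element has at most
   two even elements and at most one odd one.  If it has evens [a != b] and an
   odd [c], alternating the reflections [z |-> u - z], [u = a, b, c], shows that
   the colouring is periodic up to few exceptions, which forces [2 c = a + b].
   Conversely, explicit 2-colourings exist for the sets listed. *)

Import GRing.Theory.
Local Open Scope classical_set_scope.
Local Open Scope ring_scope.

Lemma avoidable_coloring {U : set int} : avoidable (fun x y : int => x + y) U ->
  exists f : int -> bool, forall u z, U u -> z != u - z -> f (u - z) = ~~ f z.
Proof.
move=> [A [B [[_ _ AB0 ABT] UA UB]]]; exists (fun z => `[< A z >]) => u z Uu zne.
have AoB w : A w \/ B w by have : (A `|` B) w by rewrite ABT.
have BnA w : B w -> ~ A w.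
  by move=> Bw Aw; have : (A `&` B) w by []; rewrite AB0.
have sumE : z + (u - z) = u by lia.
case: (AoB z) => Hz.
  rewrite (asboolT Hz); apply: asboolF => Huz.
  by apply: (UA _ _ Hz Huz); [exact/eqP | rewrite sumE].
rewrite (asboolF (BnA _ Hz)); apply: asboolT.
case: (AoB (u - z)) => // Huz; exfalso.
by apply: (UB _ _ Hz Huz); [exact/eqP | rewrite sumE].
Qed.

Lemma coloring_avoidable {U : set int} {f : int -> bool} : U !=set0 ->
  (forall u z, U u -> z != u - z -> f (u - z) = ~~ f z) ->
  avoidable (fun x y : int => x + y) U.
Proof.
move=> [u0 Uu0] Hf.
(* A reflection fixes at most one integer, so [0] or [1] works; [z] and [u0 - z] then get opposite
   colours, which makes both blocks nonempty. *)
have [z zne] : exists z, z != u0 - z.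
  by have [E|?] := eqVneq (0 : int) (u0 - 0); [exists 1; lia | exists 0].
have Hz := Hf u0 z Uu0 zne.
exists [set w | f w], [set w | ~~ f w]; split.
- split.
  + by case fz: (f z); [exists z | exists (u0 - z); rewrite /= Hz fz].
  + by case fz: (f z); [exists (u0 - z); rewrite /= Hz fz | exists z; rewrite /= fz].
  + by apply/seteqP; split=> w //= [->].
  + by apply/seteqP; split=> w //= _; case: (f w); [left | right].
- move=> x y /= fx fy xy Uxy; have := Hf _ x Uxy.
  by rewrite [x + y]addrC addrK fx fy => /(_ (introN eqP xy)).
- move=> x y /= fx fy xy Uxy; have := Hf _ x Uxy.
  rewrite [x + y]addrC addrK (negbTE fx) (negbTE fy).
  by move=> /(_ (introN eqP xy)).
Qed.

(* The triangle has vertices [x, a - x, c - x] with [2 x = a + c - b]. *)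
Lemma avoidable_odd_sum3 {U : set int} {a b c : int} :
  avoidable (fun x y : int => x + y) U -> U a -> U b -> U c ->
  a != b -> b != c -> a != c -> ~~ (2 %| a + b + c)%Z.
Proof.
move=> /avoidable_coloring [f Hf] Ua Ub Uc ab bc ac.
apply/negP => /dvdzP [s sE].
pose x := s - b.
have e1 := Hf a x Ua ltac:(rewrite /x; lia).
have e2 := Hf b (a - x) Ub ltac:(rewrite /x; lia).
have e3 := Hf c x Uc ltac:(rewrite /x; lia).
have E : b - (a - x) = c - x by rewrite /x; lia.
by move: e2; rewrite E e3 e1 negbK; case: (f x).
Qed.

Lemma coloring_midpoint (g : int -> bool) (m d : int) : m != 0 ->
  ~~ (2 %| d)%Z ->
  (forall z, z != - z -> g (- z) = ~~ g z) ->
  (forall z, z != 2 * m - z -> g (2 * m - z) = ~~ g z) ->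
  (forall z, z != d - z -> g (d - z) = ~~ g z) -> d = m.
Proof.
move=> m0 dodd H0 Hm Hd; apply/eqP/negPn/negP => dm.
have d0 : d != 0 by lia.
(* Two reflections compose to a translation; [z = 0] is excluded as the fixed point of [z |-> - z],
   while [z |-> d - z] has none because [d] is odd. *)
have per_d z : z != 0 -> g (z + d) = g z.
  move=> z0; have -> : z + d = d - - z by lia.
  by rewrite Hd ?H0 ?negbK //; lia.
have per_m z : z != 0 -> z != - m -> g (z + 2 * m) = g z.
  move=> z0 zm; have -> : z + 2 * m = 2 * m - - z by lia.
  by rewrite Hm ?H0 ?negbK //; lia.
have gd : g d = ~~ g 0 by rewrite -{1}[d]subr0 Hd //; lia.
(* At [z = - m] the period [2 * m] may fail, so the case [d = - m] compares [0], [2 * d] and [d]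
   instead. *)
have [dmE|dNm] := eqVneq d (- m).
  have := per_m (2 * d) ltac:(lia) ltac:(lia).
  have -> : 2 * d + 2 * m = 0 by lia.
  have -> : 2 * d = d + d by lia.
  by rewrite per_d // gd; case: (g 0).
have gNd : g (- d) = g 0 by rewrite -(per_d (- d)) ?addNr //; lia.
(* The chain [d], [d + 2 * m], [2 * m], [2 * m - d], [- d], [0] has a single colour, against
   [gd]. *)
have e1 := per_m d d0 dNm.
have e2 := per_m (- d) ltac:(lia) ltac:(lia).
have e3 := per_d (2 * m) ltac:(lia).
have e4 := per_d (- d + 2 * m) ltac:(lia).
have E : - d + 2 * m + d = 2 * m by lia.
rewrite E in e4; rewrite addrC in e3.
by move: e1; rewrite e3 e4 e2 gNd gd; case: (g 0).
Qed.

Lemma avoidable_midpoint {U : set int} {a b c : int} :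
  avoidable (fun x y : int => x + y) U -> U a -> U b -> U c ->
  (2 %| a)%Z -> (2 %| b)%Z -> ~~ (2 %| c)%Z -> a != b -> 2 * c = a + b.
Proof.
move=> /avoidable_coloring [f Hf] Ua Ub Uc /dvdzP [s aE] /dvdzP [t bE] c2 ab.
(* Translating the colouring by [s], half of [a], lowers every sum by [a]: the sums [a], [b], [c]
   become [0], [2 * (t - s)], [c - 2 * s]. *)
suff : c - 2 * s = t - s by lia.
apply: (@coloring_midpoint (fun z => f (z + s))); try lia.
- by move=> z zne; rewrite -(Hf a) //; [congr f; lia | lia].
- by move=> z zne; rewrite -(Hf b) //; [congr f; lia | lia].
- by move=> z zne; rewrite -(Hf c) //; [congr f; lia | lia].
Qed.

(** Designed for the sums [0], [x], [2 * x]: reflection pairs the remainders [r] and [x - r], which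
    lie on opposite sides of [x / 2]. The self-paired remainders [0] and [x / 2] are split by the
    sign and the parity of the quotient. *)
Definition ap_coloring (x z : int) : bool :=
  let q := (z %/ x)%Z in let r := (z %% x)%Z in
  if r == 0 then 0 < q else if 2 * r == x then (2 %| q)%Z else 2 * r < x.

Lemma ap_coloringE (x q r : int) : 0 <= r < x ->
  ap_coloring x (q * x + r) =
  if r == 0 then 0 < q else if 2 * r == x then (2 %| q)%Z else 2 * r < x.
Proof.
move=> /andP [r0 rx]; have x0 : x != 0 by lia.
have rxx : (0 <= r < `|x|)%R by lia.
by rewrite /ap_coloring divzMDl // modzMDl divz_small // modz_small ?addr0; lia.
Qed.

(* For [k = 1] and [x] even, [z] and [x - z] may both be odd multiples of
   [x / 2] with quotients of the same parity. *)
Lemma ap_coloring_reflect (x k z : int) : 0 < x ->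
  k = 0 \/ k = 2 \/ k = 1 /\ ~~ (2 %| x)%Z ->
  z != k * x - z -> ap_coloring x (k * x - z) = ~~ ap_coloring x z.
Proof.
move=> x0 Hk.
have [r0 rx] : 0 <= (z %% x)%Z /\ (z %% x)%Z < x.
  by split; [apply: modz_ge0; lia | apply: ltz_pmod].
rewrite (divz_eq z x); move: (z %/ x)%Z (z %% x)%Z r0 rx => q r r0 rx.
have [->|rn0] := eqVneq r 0 => zne.
  have -> : k * x - (q * x + 0) = (k - q) * x + 0 by ring.
  have kq : k != 2 * q.
    by apply: contraNneq zne => ->; apply/eqP; ring.
  by rewrite !ap_coloringE ?eqxx; lia.
have -> : k * x - (q * x + r) = (k - 1 - q) * x + (x - r) by ring.
rewrite !ap_coloringE; try lia.
have -> : (x - r == 0) = false by lia.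
rewrite (negbTE rn0); have -> : (2 * (x - r) == x) = (2 * r == x) by lia.
by case: eqP => rxE; clear zne; lia.
Qed.

Lemma avoidable_coloring_shift (U : set int) (a x : int) : (2 %| a)%Z -> 0 < x ->
  U !=set0 ->
  (forall u, U u -> exists2 k, u = a + k * x &
     k = 0 \/ k = 2 \/ k = 1 /\ ~~ (2 %| x)%Z) ->
  avoidable (fun x y : int => x + y) U.
Proof.
move=> /dvdzP [s aE] x0 U0 HU.
apply: (@coloring_avoidable _ (fun z => ap_coloring x (z - s)) U0) => u z.
move=> /HU [k uE Hk] zne; rewrite -(@ap_coloring_reflect x k) //; last lia.
by congr ap_coloring; lia.
Qed.

Lemma avoidable_ap {a x : int} : (2 %| a)%Z -> ~~ (2 %| x)%Z ->
  avoidable (fun x y : int => x + y) [set a; a + x; a + 2 * x].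
Proof.
move=> a2 x2; have [x0|x0] : 0 < x \/ 0 < - x by lia.
  apply: (@avoidable_coloring_shift _ a x) => //; first by exists a; left; left.
  by move=> u [[|]|] /= ->; [exists 0 | exists 1 | exists 2]; lia.
(* For negative [x] the progression is read from its other end. *)
apply: (@avoidable_coloring_shift _ (a + 2 * x) (- x)) => //; first lia.
  by exists a; left; left.
by move=> u [[|]|] /= ->; [exists 2 | exists 1 | exists 0]; lia.
Qed.

(** With an even step of absolute value [2 * |x|], the two sums have [k = 0] and [k = 2], so [k = 1]
    never occurs. *)
Lemma avoidable_pair {a x : int} : (2 %| a)%Z -> x != 0 ->
  avoidable (fun x y : int => x + y) [set a; a + 4 * x].
Proof.
move=> a2 xn0; have [x0|x0] : 0 < x \/ 0 < - x by lia.
  apply: (@avoidable_coloring_shift _ a (2 * x)) => //; first lia.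
    by exists a; left.
  by move=> u [|] /= ->; [exists 0 | exists 2]; lia.
apply: (@avoidable_coloring_shift _ (a + 4 * x) (- 2 * x)) => //; try lia.
  by exists a; left.
by move=> u [|] /= ->; [exists 2 | exists 0]; lia.
Qed.

Lemma odd_setE :
  [set x : int | exists l : int, x = 2 * l + 1] = [set x | ~~ (2 %| x)%Z].
Proof.
apply/seteqP; split=> [_ [l ->] /=|x /= x2]; first lia.
by exists (x %/ 2)%Z; lia.
Qed.

Lemma avoidable_odd :
  avoidable (fun x y : int => x + y) [set x : int | ~~ (2 %| x)%Z].
Proof.
apply: (@coloring_avoidable _ (fun z => (2 %| z)%Z)); first by exists 1.
by move=> u z /= u2 _; lia.
Qed.

(** An odd element forces any second even one to be the mirror image of [a] in it; without odd
    elements at most two even ones remain. *)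
Lemma avoidable_even_sub {U : set int} {a : int} :
  avoidable (fun x y : int => x + y) U -> U a -> (2 %| a)%Z ->
  (exists x, ~~ (2 %| x)%Z /\ U `<=` [set a; a + x; a + 2 * x]) \/
  (exists x, x != 0 /\ U `<=` [set a; a + 4 * x]).
Proof.
move=> avU Ua a2.
have tri b c : U b -> U c -> (2 %| a + b + c)%Z -> a != b -> a != c -> b = c.
  move=> Ub Uc abc ab ac; apply/eqP/negPn/negP => bc.
  by have := @avoidable_odd_sum3 U a b c avU Ua Ub Uc ab bc ac; rewrite abc.
have [[c [Uc c2]]|noodd] := pselect (exists c, U c /\ ~~ (2 %| c)%Z).
  left; exists (c - a); split; first lia.
  move=> w Uw; have [w2|w2] := boolP (2 %| w)%Z.
    have [->|wa] := eqVneq w a; first by left; left.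
    right => /=.
    have := @avoidable_midpoint U a w c avU Ua Uw Uc a2 w2 c2 ltac:(lia); lia.
  by left; right => /=; rewrite (tri w c) //; lia.
have even w : U w -> (2 %| w)%Z.
  by move=> Uw; apply/negPn/negP => w2; apply: noodd; exists w.
have [[b [Ub ba]]|nob] := pselect (exists b, U b /\ b != a).
  have b2 := even _ Ub.
  have Uab w : U w -> w = a \/ w = b.
    move=> Uw; have [->|wa] := eqVneq w a; [by left | right].
    by have w2 := even _ Uw; apply: tri => //; lia.
  (* If [4] does not divide [b - a], half of it is odd and the pair forms the ends of a three-term
     progression. *)
  have [d4|d4] := boolP (4 %| b - a)%Z.
    right; exists ((b - a) %/ 4)%Z; split; first lia.
    by move=> w /Uab [->|->]; [left | right => /=; lia].
  left; exists ((b - a) %/ 2)%Z; split; first lia.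
  by move=> w /Uab [->|->]; [left; left | right => /=; lia].
left; exists 1; split=> // w Uw; left; left => /=.
by apply/eqP/negPn/negP => wa; apply: nob; exists w.
Qed.

Theorem theorem2p5 (U : set int) :
  saturated (fun x y : int => x + y) U <->
  [\/ U = [set x : int | exists l : int, x = 2 * l + 1],
      exists a x : int, [/\ (2 %| a)%Z, ~~ (2 %| x)%Z &
        U = [set a; a + x; a + 2 * x]]
    | exists a x : int, [/\ (2 %| a)%Z, x != 0 & U = [set a; a + 4 * x]]].
Proof.
rewrite odd_setE; split.
  move=> [avU maxU].
  have [[a [Ua a2]]|noeven] := pselect (exists a, U a /\ (2 %| a)%Z).
    have [[x [x2 UV]]|[x [x0 UV]]] := avoidable_even_sub avU Ua a2.
      apply: Or32; exists a, x; split=> //.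
      by rewrite (maxU _ (avoidable_ap a2 x2) UV).
    apply: Or33; exists a, x; split=> //.
    by rewrite (maxU _ (avoidable_pair a2 x0) UV).
  apply: Or31; rewrite (maxU _ avoidable_odd) // => w Uw /=.
  by apply/negP => w2; apply: noeven; exists w.
have tri V a b c : avoidable (fun x y : int => x + y) V -> V a -> V b -> V c ->
    (2 %| a + b + c)%Z -> a != b -> c = a \/ c = b.
  move=> avV Va Vb Vc abc ab.
  have [->|ca] := eqVneq c a; [by left | right]; apply/eqP/negPn/negP => cb.
  have := avoidable_odd_sum3 avV Va Vb Vc; rewrite abc; lia.
case=> [->|[a [x [a2 x2 ->]]]|[a [x [a2 x0 ->]]]].
- split=> [|V avV UV]; first exact: avoidable_odd.
  apply/seteqP; split=> // w Vw /=; apply/negP => w2.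
  have V1 : V 1 by exact: UV.
  have V3 : V 3 by exact: UV.
  by have [|||] := tri V 1 3 w avV V1 V3 Vw; lia.
- split=> [|V avV UV]; first exact: avoidable_ap.
  have Va : V a by apply: UV; left; left.
  have Vax : V (a + x) by apply: UV; left; right.
  have Va2x : V (a + 2 * x) by apply: UV; right.
  (* By the parity of [w], two terms are chosen whose sum with [w] is even. *)
  apply/seteqP; split=> // w Vw /=; have [w2|w2] := boolP (2 %| w)%Z.
    by have [|||] := tri V a (a + 2 * x) w avV Va Va2x Vw; lia.
  by have [|||] := tri V a (a + x) w avV Va Vax Vw; lia.
- split=> [|V avV UV]; first exact: avoidable_pair.
  have Va : V a by apply: UV; left.
  have Vax : V (a + 4 * x) by apply: UV; right.
  apply/seteqP; split=> // w Vw /=; have [w2|w2] := boolP (2 %| w)%Z.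
    by have [|||] := tri V a (a + 4 * x) w avV Va Vax Vw; lia.
  (* An odd [w] would equal the midpoint [a + 2 * x], which is even. *)
  have := avoidable_midpoint avV Va Vax Vw a2 _ w2; lia.
Qed.
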